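(* Let $\mathcal{H}$ be a Hilbert space, let $\mathcal{K},\mathcal{E}$ be Krein spaces, and let $T\in\mathcal{L}(\mathcal{H},\mathcal{K})$ and $V\in\mathcal{L}(\mathcal{H},\mathcal{E})$ be closed range operators. Assume that $T^\#T$ and $V^\#V$ are indefinite and that $[Ty,Ty]_{\mathcal{K}}\geq0$ for every $y\in\mathcal{H}$ with $[Vy,Vy]_{\mathcal{E}}=0$. Let $Lx=(Tx,Vx)$ for $x\in\mathcal{H}$, and suppose that $\rho_-\neq\rho_+$. If $R(L)$ is a regular subspace of $(\mathcal{K}\times\mathcal{E},[\cdot,\cdot]_{\rho_0})$ for some $\rho_0\in(\rho_-,\rho_+)$, then it is a regular subspace of $(\mathcal{K}\times\mathcal{E},[\cdot,\cdot]_\rho)$ for all $\rho\in(\rho_-,\rho_+)$.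
   Context: $(\mathcal{H},\langle\cdot,\cdot\rangle)$ is a complex separable Hilbert space; $R(\cdot)$ denotes range. The Krein space adjoints are defined by $[Tx,y]_{\mathcal{K}}=\langle x,T^\#y\rangle$ and $[Vx,z]_{\mathcal{E}}=\langle x,V^\#z\rangle$. A bounded selfadjoint operator $C$ on $\mathcal{H}$ is indefinite if $\langle Cx,x\rangle$ takes both strictly positive and strictly negative values. For $\rho\neq0$, $\mathcal{K}\times\mathcal{E}$ is a Krein space with $[(y,z),(y',z')]_\rho=[y,y']_{\mathcal{K}}+\rho\,[z,z']_{\mathcal{E}}$. Define $$\rho_-=-\inf_{\{x\in\mathcal{H}:[Vx,Vx]_{\mathcal{E}}>0\}}\frac{[Tx,Tx]_{\mathcal{K}}}{[Vx,Vx]_{\mathcal{E}}},\qquad \rho_+=-\sup_{\{x\in\mathcal{H}:[Vx,Vx]_{\mathcal{E}}<0\}}\frac{[Tx,Tx]_{\mathcal{K}}}{[Vx,Vx]_{\mathcal{E}}}.$$ Under the stated hypotheses these are real numbers with $\rho_-\leq\rho_+$, the operator $T^\#T+\rho V^\#V$ is positive semidefinite if and only if $\rho\in[\rho_-,\rho_+]$, and $0\notin[\rho_-,\rho_+]$. A subspace $\mathcal{M}$ of a Krein space $(\mathcal{F},[\cdot,\cdot])$ is regular if $\mathcal{M}+\mathcal{M}^{[\perp]}=\mathcal{F}$, where $\mathcal{M}^{[\perp]}=\{x\in\mathcal{F}:[x,m]=0\ \forall m\in\mathcal{M}\}$. *)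

(* Defs.v *)
From HB Require Import structures.
From mathcomp Require Import all_boot all_order all_algebra sesquilinear.
From mathcomp Require Import complex.
From mathcomp Require Import all_classical all_reals all_analysis.

Set Implicit Arguments.
Unset Strict Implicit.
Unset Printing Implicit Defensive.

Import Order.TTheory GRing.Theory Num.Theory.
Import numFieldNormedType.Exports.

Local Open Scope classical_set_scope.
Local Open Scope ring_scope.

(* The order of R[i] is partial: [0 < z] says that z is real and positive, so *)
(* the inequalities between complex numbers below are inequalities between    *)
(* real ones.  Forms are linear in the first argument and conjugate-linear in *)
(* the second.                                                                *)

Definition separable_space (X : topologicalType) :=
  exists2 D : set X, countable D & dense D.

(* The completeness of H is part of its type. *)
Definition hilbert_space (R : realType) (H : completeNormedModType R[i])
    (dot : {dot H for Num.conj}) :=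
  forall x : H, dot x x = `|x| ^+ 2.

Definition form_complete (R : realType) (F : lmodType R[i])
    (g : F -> F -> R[i]) (M : set F) :=
  forall u : nat -> F, (forall n, M (u n)) ->
    (forall e : R[i], 0 < e -> exists N, forall m n, (N <= m)%N -> (N <= n)%N ->
       g (u m - u n) (u m - u n) < e) ->
    exists2 l, M l & forall e : R[i], 0 < e -> exists N, forall n, (N <= n)%N ->
       g (u n - l) (u n - l) < e.

Definition hilbert_subspace (R : realType) (F : lmodType R[i])
    (g : F -> F -> R[i]) (M : set F) :=
  [/\ submod_closed [in M],
      forall x, M x -> x != 0 -> 0 < g x x
    & form_complete g M].

(* The sum is direct, since the form is positive on Fp and negative on Fm. *)
Definition fundamental_decomposition (R : realType) (F : lmodType R[i])
    (f : {hermitian_sym F for Num.conj}) (Fp Fm : set F) :=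
  [/\ hilbert_subspace f Fp,
      hilbert_subspace (fun x y => - f x y) Fm,
      forall x y, Fp x -> Fm y -> f x y = 0
    & [set x + y | x in Fp & y in Fm] = setT].

(* A Krein space has a canonical topology but no canonical norm: the norm of  *)
(* F is only asked to be equivalent to the Hilbert norm                       *)
(* x + y |-> sqrt (f x x - f y y) of a fundamental decomposition.  (All these *)
(* Hilbert norms are equivalent.)                                             *)
Definition krein_space (R : realType) (F : completeNormedModType R[i])
    (f : {hermitian_sym F for Num.conj}) :=
  exists Fp Fm : set F, fundamental_decomposition f Fp Fm /\
    exists a b : R[i], [/\ 0 < a, 0 < b &
      forall x y, Fp x -> Fm y ->
        a * `|x + y| ^+ 2 <= f x x - f y y <= b * `|x + y| ^+ 2].

(* T^# y is the vector z such that [T x, y] = <x, z> for all x, which exists  *)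
(* and is unique when T is bounded; the default value 0 is then never used.   *)
Definition krein_adjoint (R : realType) (H F : lmodType R[i])
    (dot : H -> H -> R[i]) (f : F -> F -> R[i]) (T : H -> F) : F -> H :=
  fun y => xget 0 [set z | forall x, f (T x) y = dot x z].

Definition indefinite (R : realType) (H : lmodType R[i])
    (dot : H -> H -> R[i]) (C : H -> H) :=
  (exists x, 0 < dot (C x) x) /\ (exists x, dot (C x) x < 0).

Definition orthogonal_companion (R : realType) (F : lmodType R[i])
    (g : F -> F -> R[i]) (M : set F) : set F :=
  [set x | forall m, M m -> g x m = 0].

Definition regular_subspace (R : realType) (F : lmodType R[i])
    (g : F -> F -> R[i]) (M : set F) :=
  submod_closed [in M] /\
  [set x + y | x in M & y in orthogonal_companion g M] = setT.

Definition rho_form (R : realType) (K E : lmodType R[i])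
    (kf : K -> K -> R[i]) (ef : E -> E -> R[i]) (rho : R)
    (p q : K * E) : R[i] :=
  kf p.1 q.1 + (rho%:C)%C * ef p.2 q.2.

Section rho_bounds.
Context (R : realType) (H K E : lmodType R[i]).
Variables (kf : K -> K -> R[i]) (ef : E -> E -> R[i]) (T : H -> K) (V : H -> E).

(* [Tx,Tx] and [Vx,Vx] are real for the Hermitian forms considered. *)
Definition rho_quotient (x : H) : R :=
  complex.Re (kf (T x) (T x)) / complex.Re (ef (V x) (V x)).

(* As extended real numbers, so that the infimum and the supremum need no     *)
(* boundedness condition.                                                     *)
Definition rho_minus : \bar R :=
  (- ereal_inf [set (rho_quotient x)%:E |
     x in [set x | (0 < ef (V x) (V x))%R]])%E.

Definition rho_plus : \bar R :=
  (- ereal_sup [set (rho_quotient x)%:E |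
     x in [set x | (ef (V x) (V x) < 0)%R]])%E.

End rho_bounds.

(* Main.v *)
Require Import Defs.
From HB Require Import structures.
From mathcomp Require Import all_boot all_order all_algebra sesquilinear.
From mathcomp Require Import complex.
From mathcomp Require Import all_classical all_reals all_analysis.
From mathcomp Require Import ring lra.
Set Implicit Arguments.
Unset Strict Implicit.
Unset Printing Implicit Defensive.

Import Order.TTheory GRing.Theory Num.Theory.
Import numFieldNormedType.Exports.

Local Open Scope classical_set_scope.
Local Open Scope ring_scope.

(** Write [q_rho (x, y) = [T x, T y] + rho [V x, V y]] for the form that
    [[ , ]_rho] induces on [M = R(L)] through [L].

    Regularity of [M] for a form [g] says that every functional [g (w, .)] on
    [M], with [w] in the whole space, is represented by a vector of [M].  For
    [rho] and [rho0] nonzero these functionals are the same for both forms,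
    because [g_rho (w, .) = g_rho0 (w', .)] when [w'] is [w] with its second
    component multiplied by [rho / rho0].  Moreover [0] is outside the open
    interval: there [q_rho >= 0], whereas [q_0] is the form of [T^# T], which
    takes negative values.

    Inside the open interval one can move [rho] a little in both directions and
    keep [q_rho >= 0], so [d |[V x, V x]| <= q_rho (x, x)] for some [d > 0]
    ([rho_interval_coercive]).  Hence [q_rho0] and [q_rho] are equivalent, with
    constants [0 < c <= d].  It remains to transfer representability between
    equivalent positive forms ([orthoprojectable_perturb]), which is a
    Lax-Milgram argument: to represent a functional by [g], iterate
    [v |-> v + (1/d) r], where [r] represents the residual of [v] for [g0].  The
    energy [g0 (r, r)] is contracted by [1 - c/d] at each step.

    For the iterates to converge, [M] must be complete for the energy norm.  Let
    [M] be regular for [g0] and [g0 >= 0] on [M].  For a fixed [y] with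
    projection [p] on [M], and [u] in [M] with [g0 (u, u) <= 1], the
    Cauchy-Schwarz inequality gives [|g0 (y, u)|^2 <= g0 (p, p)].  The functionals
    [g0 (., u)] are therefore pointwise bounded, hence uniformly bounded
    ([uniform_boundedness]), and since a Krein form controls the norm,
    [|u|^2 <= k g0 (u, u)] on [M] ([orthoprojectable_form_norm]).  Together with
    the closedness of [M] ([orthoprojectable_closed]) this is completeness.

    The arguments about forms use only two features of a Krein space: its form
    is bounded, and it satisfies an inf-sup inequality with respect to the norm.
    Both pass to the product [K * E] with the form [[ , ]_rho], [rho <> 0]. *)

(** * Completeness of products *)

Section prod_complete.
Context {T U : completeType}.

(* Makes the join of the pointed and uniform structures of a product known. *)
HB.instance Definition _ := Pointed.on (T * U)%type.

Lemma prod_complete (F : set_system (T * U)%type) :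
  ProperFilter F -> cauchy F -> cvg F.
Proof.
move=> FF Fc.
have /cauchy_cvg/cvg_ex[a Fa] : cauchy (fst @ F).
  move=> A entA; rewrite near_simpl -near2E near_map2.
  by apply: filterS (Fc _ (prod_entP entA (@entourageT U))) => xy [].
have /cauchy_cvg/cvg_ex[b Fb] : cauchy (snd @ F).
  move=> A entA; rewrite near_simpl -near2E near_map2.
  by apply: filterS (Fc _ (prod_entP (@entourageT T) entA)) => xy [].
apply/cvg_ex; exists (a, b) => A nA.
have : F ((fun x => (x.1, x.2)) @^-1` A) by exact: (cvg_pair Fa Fb nA).
by apply: (@filterS _ F) => -[].
Qed.

HB.instance Definition _ := Uniform_isComplete.Build (T * U)%type prod_complete.

End prod_complete.

(* Makes the join of the normed and complete structures of a product known. *)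
HB.instance Definition _ (C : numFieldType) (K E : completeNormedModType C) :=
  Complete.on (K * E)%type.

(** * Geometrically convergent sequences *)

Section geometric.
Variable C : numFieldType.
Hypothesis archi : Num.archimedean_axiom C.
Implicit Types (s e : C) (r : nat -> C).

(** The induction is on the stronger bound [s^n (1 + n (1 - s)) <= 1], a form of
    Bernoulli's inequality that also holds for [s = 0]. *)
Lemma bernoulli_inv s n : 0 <= s <= 1 -> s ^+ n * (n%:R * (1 - s)) <= 1.
Proof.
move=> /andP[s0 s1].
have h0 : 0 <= 1 - s by rewrite subr_ge0.
suff : s ^+ n * (1 + n%:R * (1 - s)) <= 1.
  by apply: le_trans; rewrite ler_wpM2l ?exprn_ge0 // lerDr.
elim: n => [|n IHn]; first by rewrite mul0r addr0 mulr1.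
rewrite -natr1 [_ * (1 - s)]mulrDl mul1r addrA mulrDr exprS -mulrA.
have E : s * 1 + 1 * (1 - s) = 1 by rewrite mulr1 mul1r addrC subrK.
rewrite -[leRHS]E.
by rewrite lerD ?ler_wpM2l // -exprS ler_wpM2r // exprn_ile1.
Qed.

Lemma geometric_le s r : 0 <= s -> (forall n, r n.+1 <= s * r n) ->
  forall n, r n <= r 0%N * s ^+ n.
Proof.
move=> s0 rS; elim=> [|n IHn]; first by rewrite mulr1.
by apply: le_trans (rS n) _; rewrite exprS mulrCA ler_wpM2l.
Qed.

Lemma geometric_small s r : 0 <= s < 1 -> (forall n, 0 <= r n) ->
  (forall n, r n.+1 <= s * r n) ->
  forall e, 0 < e -> exists N, forall n, (N <= n)%N -> r n <= e.
Proof.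
case/andP=> s0 s1 r0 rS e e0.
have h0 : 0 < 1 - s by rewrite subr_gt0.
have eh0 : 0 < e * (1 - s) by rewrite mulr_gt0.
have [N] := archi (r 0%N / (e * (1 - s))).
rewrite ger0_norm; last by rewrite divr_ge0 // ltW.
rewrite ltr_pdivrMr // => /ltW rN.
exists N => n Nn; apply: le_trans (geometric_le s0 rS n) _.
have rn : r 0%N <= e * (n%:R * (1 - s)).
  by rewrite mulrCA; apply: le_trans rN _; rewrite ler_wpM2r ?ler_nat ?ltW.
apply: le_trans (ler_wpM2r (exprn_ge0 n s0) rn) _.
rewrite -mulrA; apply: ler_piMr; first exact: ltW.
by rewrite mulrC bernoulli_inv // s0 ltW.
Qed.

(** The bounds on the steps telescope, because
    [r n <= r n / (1 - s) - r n.+1 / (1 - s)]. *)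
Lemma geometric_cvg (F : completeNormedModType C) (u : nat -> F) s r :
  0 <= s < 1 -> (forall n, `|u n.+1 - u n| <= r n) ->
  (forall n, r n.+1 <= s * r n) ->
  exists l, forall n, `|u n - l| <= r n / (1 - s).
Proof.
move=> s01 ur rS; have /andP[s0 s1] := s01.
have r0 n : 0 <= r n by apply: le_trans (ur n).
have s1' : 0 < 1 - s by rewrite subr_gt0.
pose t n := r n / (1 - s).
have t0 n : 0 <= t n by rewrite divr_ge0 // ltW.
have tS n : t n.+1 <= s * t n by rewrite /t mulrA ler_pM2r ?invr_gt0.
have tD n k : `|u (n + k)%N - u n| <= t n.
  suff: `|u (n + k)%N - u n| <= t n - t (n + k)%N.
    by move=> /le_trans; apply; rewrite gerBl.
  elim: k => [|k IHk]; first by rewrite addn0 !subrr normr0.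
  rewrite addnS; have /le_trans : `|u (n + k).+1 - u n| <=
    `|u (n + k).+1 - u (n + k)%N| + `|u (n + k)%N - u n| by
    rewrite -[in leLHS](subrKA (u (n + k)%N)) ler_normD.
  apply; apply: le_trans (lerD (ur _) IHk) _.
  rewrite addrCA lerD2l.
  have -> : r (n + k)%N = t (n + k)%N - s * t (n + k)%N.
    by rewrite /t -{1}[r _ / _]mul1r -mulrBl mulrC divfK ?gt_eqF.
  by rewrite addrAC subrr add0r lerN2.
have : cvg (u @ \oo).
  apply: cauchy_cvg; apply/cauchy_exP => e e0.
  have e20 : 0 < e / 2 by rewrite divr_gt0.
  have [N HN] := geometric_small s01 t0 tS e20.
  exists (u N); exists N => // n /= Nn.
  rewrite -ball_normE /ball_/= distrC -(subnKC Nn).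
  apply: le_lt_trans (tD _ _) (le_lt_trans (HN _ (leqnn N)) _).
  by rewrite ltr_pdivrMr // ltr_pMr // ltr1n.
move=> /cvg_ex[l ul]; exists l => n.
apply/ler_addgt0Pr => e e0.
have /cvgrPdist_lt/(_ _ e0)[N _ HN] := ul.
have /HN /ltW lu : (N <= n + N)%N by rewrite leq_addl.
rewrite -[in leLHS](subrKA (u (n + N)%N)) (le_trans (ler_normD _ _)) //.
by rewrite lerD // distrC.
Qed.
End geometric.

(** * Uniform boundedness *)

Section uniform_boundedness.
Variables (C : numFieldType) (F : completeNormedModType C).
Hypothesis archi : Num.archimedean_axiom C.

Definition bounded_functional (f : F -> C) :=
  exists2 c : C, 0 < c & forall x, `|f x| <= c * `|x|.

(** A gliding hump.  If the family is not uniformly bounded, then in any ball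
    around any point some member takes an arbitrarily large value, because
    [2 f z = f (y + z) - f (y - z)].  Choosing such points in successively smaller
    balls gives a Cauchy sequence whose limit contradicts pointwise
    boundedness: the radii are chosen so small that the value reached at step
    [n] is changed by at most [1] later on. *)
Lemma uniform_boundedness (A : set (F -> C)) :
  (forall f, A f -> scalar f /\ bounded_functional f) ->
  (forall x, exists c : C, forall f, A f -> `|f x| <= c) ->
  exists2 c : C, 0 < c & forall f, A f -> forall x, `|f x| <= c * `|x|.
Proof.
move=> Alin Apt; apply: contrapT => Nbd.
have fD f : A f -> {morph f : x y / x + y}.
  by move=> /Alin[lf _] x y; have := lf 1 x y; rewrite scale1r mul1r.
have f0 f : A f -> f 0 = 0.
  by move=> Af; apply: (addrI (f 0)); rewrite -fD // !addr0.
have fZ f : A f -> forall a x, f (a *: x) = a * f x.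
  by move=> Af a x; have := (Alin f Af).1 a x 0; rewrite !addr0 f0 // addr0.
have fB f : A f -> {morph f : x y / x - y}.
  by move=> Af x y; rewrite fD // -scaleN1r fZ // mulN1r.
have large (y : F) (d c : C) : 0 < d -> 0 < c ->
    exists f z, [/\ A f, `|z - y| <= d & c < `|f z|].
  move=> d0 c0.
  have [[f [x [Af fx]]]|Nlarge] :=
      pselect (exists f x, A f /\ c / d * `|x| < `|f x|).
    have x0 : x != 0.
      by apply/eqP => x0; move: fx; rewrite x0 (f0 f Af) !normr0 mulr0 ltxx.
    pose z := (d / `|x|) *: x.
    have zd : `|z| = d.
      rewrite normrZ normrM normfV normr_id (gtr0_norm d0) divfK //.
      by rewrite normr_eq0.
    have fz : c < `|f z|.
      rewrite (fZ f Af) normrM normrM normfV normr_id (gtr0_norm d0).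
      have cE : c = d / `|x| * (c / d * `|x|).
        by field; rewrite normr_eq0 x0 gt_eqF.
      by rewrite [ltLHS]cE ltr_pM2l // divr_gt0 // normr_gt0.
    have [small|] := boolP (`|f (y + z)| <= c); last first.
      rewrite -real_ltNge ?normr_real ?gtr0_real // => big.
      by exists f, (y + z); rewrite addrAC subrr add0r zd lexx.
    have [small'|] := boolP (`|f (y - z)| <= c); last first.
      rewrite -real_ltNge ?normr_real ?gtr0_real // => big.
      by exists f, (y - z); rewrite addrAC subrr add0r normrN zd lexx.
    suff : `|f z| *+ 2 <= c *+ 2 by rewrite lerMn2r /= => /(lt_le_trans fz); rewrite ltxx.
    rewrite -normrMn (_ : f z *+ 2 = f (y + z) - f (y - z)).
      by apply: le_trans (ler_normB _ _) _; rewrite mulr2n lerD.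
    by rewrite (fB f Af) (fD f Af); ring.
  case: Nbd; exists (c / d) => [|f Af x]; first by rewrite divr_gt0.
  have [//|] := boolP (`|f x| <= c / d * `|x|).
  rewrite -real_ltNge ?normr_real ?realM ?normr_real ?realV ?gtr0_real //.
  by move=> big; case: Nlarge; exists f, x.
(* A state holds a step number, a functional, a point and a radius. *)
pose good (p q : nat * ((F -> C) * (F * C))) :=
  [/\ q.1 = p.1.+1, A q.2.1, `|q.2.2.1 - p.2.2.1| <= p.2.2.2,
     (p.1.+1)%:R < `|q.2.1 q.2.2.1| &
     [/\ 0 < q.2.2.2, q.2.2.2 <= 2^-1 * p.2.2.2 &
         forall z, `|z| <= q.2.2.2 *+ 2 -> `|q.2.1 z| <= 1]].
have step p : exists q, 0 < p.2.2.2 -> good p q.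
  have [d0|] := pselect (0 < p.2.2.2); last by move=> ?; exists p.
  have [f [z [Af zd fz]]] := large p.2.2.1 _ (p.1.+1)%:R d0 (ltr0Sn _ _).
  have [_ [c c0 fc]] := Alin f Af.
  pose d := p.2.2.2.
  (* This radius is at most [d / 2] and at most [1 / (2 c)]. *)
  exists (p.1.+1, (f, (z, (2 * (d^-1 + c))^-1))) => _.
  have dc : 0 < d^-1 + c by rewrite addr_gt0 ?invr_gt0.
  split => //=; split => //=.
  - by rewrite invr_gt0 mulr_gt0.
  - rewrite invfM ler_pM2l ?invr_gt0 // -[leRHS]invrK lef_pV2 ?posrE ?invr_gt0 //.
    by rewrite lerDl ltW.
  - move=> x xd; apply: le_trans (fc x) _; rewrite mulrC -ler_pdivlMr //.
    apply: le_trans xd _; rewrite div1r -[X in X *+ 2]mulr1 -mulrnAr invfM.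
    rewrite mulrAC mulVf ?mul1r ?lef_pV2 ?posrE // ?lerDr ?invr_ge0 ?ltW //.
have [next nextP] := choice step.
pose st n := iter n next (0%N, (fun=> 0, (0, 1))).
have d_gt0 n : 0 < (st n).2.2.2.
  by elim: n => [|n IHn]; [exact: ltr01 | case: (nextP _ IHn) => _ _ _ _ []].
have stP n : good (st n) (st n.+1) by exact: nextP.
have st1 n : (st n).1 = n by elim: n => // n IHn; have [-> _ _ _ _] := stP n; rewrite IHn.
have half01 : 0 <= (2^-1 : C) < 1 by rewrite invr_ge0 ler0n invf_lt1 ?ltr1n.
have [l yl] : exists l, forall n, `|(st n).2.2.1 - l| <= (st n).2.2.2 / (1 - 2^-1).
  apply: (geometric_cvg archi half01) => n.
    by have [_ _ + _ _] := stP n.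
  by have [_ _ _ _ []] := stP n.
have [c fc] := Apt l; have [N cN] := archi c.
have [_ Af _ fN [_ _ f1]] := stP N.
have c0 : 0 <= c by apply: le_trans (fc _ Af).
rewrite ger0_norm // in cN.
suff : N.+1%:R < c + 1 by rewrite -natr1 ltrD2r => /(lt_trans cN); rewrite ltxx.
rewrite st1 in fN; apply: lt_le_trans fN _.
rewrite -[(st N.+1).2.2.1](subrK l) (fD _ Af) addrC; apply: le_trans (ler_normD _ _) _.
rewrite lerD ?fc // f1 //.
suff -> : (st N.+1).2.2.2 *+ 2 = (st N.+1).2.2.2 / (1 - 2^-1) by [].
by rewrite -mulr_natr; field.
Qed.
End uniform_boundedness.

(** * Hermitian forms *)

Section hermitian_forms.
Variables (C : numClosedFieldType) (F : lmodType C).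
Implicit Types (g : {hermitian_sym F for (@Num.conj C)}) (x y : F).

Lemma hermitian_conj g x y : g x y = (g y x)^*.
Proof. by rewrite hermC expr0 mul1r. Qed.

Lemma hermitian_normC g x y : `|g x y| = `|g y x|.
Proof. by rewrite hermitian_conj norm_conjC. Qed.

Lemma hermitian_real g x : g x x \is Num.real.
Proof. by apply/CrealP; rewrite -hermitian_conj. Qed.

Lemma hermitianDl g x y z : g (x + y) z = g x z + g y z.
Proof. exact: linearDl. Qed.

Lemma hermitianZl g a x y : g (a *: x) y = a * g x y.
Proof. exact: linearZl_LR. Qed.

Lemma hermitianDr g x y z : g x (y + z) = g x y + g x z.
Proof. exact: linearDr. Qed.

Lemma hermitianZr g a x y : g x (a *: y) = a^* * g x y.
Proof. exact: linearZr_LR. Qed.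

Lemma hermitianBl g x y z : g (x - y) z = g x z - g y z.
Proof. exact: linearBl. Qed.

Lemma hermitianBr g x y z : g x (y - z) = g x y - g x z.
Proof. exact: linearBr. Qed.

(** Positivity is only required on the line through [x] directed by [y] and at
    [y], so that the inequality applies to a form that is positive on a subspace
    of an indefinite space. *)
Lemma cauchy_schwarz g x y :
  (forall a, 0 <= g (x + a *: y) (x + a *: y)) -> 0 <= g y y ->
  `|g x y| ^+ 2 <= g x x * g y y.
Proof.
move=> pos yy0; set c := g y y in yy0 *.
pose d := `|g x y| ^+ 2; have d0 : 0 <= d by rewrite exprn_ge0.
have quad s : 0 <= s -> 0 <= g x x - s * d *+ 2 + s ^+ 2 * d * c.
  move=> s0; have := pos (- (s * g x y)).
  rewrite hermitianDl !hermitianDr !hermitianZl !hermitianZr -/c.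
  rewrite [g y x]hermitian_conj rmorphN rmorphM /= (conj_Creal (ger0_real s0)).
  by rewrite /d normCK; congr (0 <= _); ring.
have xx0 : 0 <= g x x by have := pos 0; rewrite scale0r addr0.
(* If [g y y = 0], the real parameter [s] below makes the quadratic equal to
   [- (g x x + 2)]; otherwise [s = 1 / g y y] minimizes it. *)
rewrite -/d; have [c0|c0] := eqVneq c 0.
  have [->|dn0] := eqVneq d 0; first by rewrite c0 mulr0.
  have dp : 0 < d by rewrite lt_def dn0.
  have := quad ((g x x + 1) / d) (divr_ge0 (addr_ge0 xx0 ler01) d0).
  rewrite c0 mulr0 addr0 divfK //
    (_ : _ - _ *+ 2 = - (g x x + 2)); last by ring.
  by rewrite oppr_ge0 lt_geF // ltr_wpDl.
have cp : 0 < c by rewrite lt_def c0.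
have := quad c^-1; rewrite invr_ge0 => /(_ yy0).
have -> : g x x - c^-1 * d *+ 2 + c^-1 ^+ 2 * d * c = g x x - d / c by field.
by rewrite subr_ge0 ler_pdivrMr.
Qed.
End hermitian_forms.

Section pack_hermitian.
Variables (C : numClosedFieldType) (F : lmodType C) (g : F -> F -> C).
Hypotheses (glin : forall z, scalar (g^~ z)) (gC : forall x y, g x y = (g y x)^*).

Let g_bilinear : bilinear_for (GRing.Scale.Law.clone _ _ *%R _)
  (GRing.Scale.Law.clone _ _ ((@Num.conj C) \; *%R) _) g.
Proof.
split=> [z a x y|z a x y]; first exact: glin.
by rewrite gC glin rmorphD rmorphM /= -!gC.
Qed.

Let g_hermitian x y : g x y = (-1) ^+ false * (g y x)^*.
Proof. by rewrite expr0 mul1r. Qed.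

(** The form [[ , ]_rho] is Hermitian only for real [rho], a side condition that
    a canonical instance cannot carry. *)
Definition pack_hermitian : {hermitian_sym F for (@Num.conj C)} :=
  HB.pack g (bilinear_isBilinear.Build _ _ _ _ _ _ g g_bilinear)
    (isHermitianSesquilinear.Build C F false (@Num.conj C) g g_hermitian).
End pack_hermitian.

(** * Regular subspaces on which the form is positive *)

Lemma sqr_norm_le0 (C : numFieldType) (V : normedZmodType C) (x : V) :
  `|x| ^+ 2 <= 0 -> x = 0.
Proof.
by move=> x0; apply/eqP; rewrite -normr_eq0 -sqrf_eq0 eq_le x0 exprn_ge0.
Qed.

Definition bounded_form (C : numClosedFieldType) (F : normedModType C)
    (g : F -> F -> C) :=
  exists2 b : C, 0 < b & forall x y, `|g x y| <= b * `|x| * `|y|.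

(** The quantitative form of nondegeneracy that a fundamental symmetry [J]
    provides, with [y] a multiple of [J x]. *)
Definition inf_sup_form (C : numClosedFieldType) (F : normedModType C)
    (g : F -> F -> C) :=
  exists2 a : C, 0 < a &
    forall x, exists2 y, `|y| <= `|x| & a * `|x| ^+ 2 <= g x y.

(** This is [M + M^[perp] = F], stated for vectors. *)
Definition orthoprojectable (C : numClosedFieldType) (F : lmodType C)
    (g : F -> F -> C) (M : set F) :=
  forall x, exists2 p, M p & forall m, M m -> g (x - p) m = 0.

Section regular_positive.
Variables (C : numClosedFieldType) (F : completeNormedModType C).
Hypothesis archi : Num.archimedean_axiom C.
Variables (g0 : {hermitian_sym F for (@Num.conj C)}) (M : set F).
Hypotheses (bg0 : bounded_form g0) (ig0 : inf_sup_form g0).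
Hypothesis Mlin : forall a x y, M x -> M y -> M (a *: x + y).
Hypothesis Mproj : orthoprojectable g0 M.

(** If [p] is the projection of the limit [l], then [l - p] is orthogonal to [M],
    and also to [M^[perp]] because [l] is a limit of vectors of [M]; so it is
    orthogonal to everything. *)
Lemma orthoprojectable_closed (u : nat -> F) l : (forall n, M (u n)) ->
  (forall e : C, 0 < e -> exists n, `|u n - l| <= e) -> M l.
Proof.
move=> Mu ul; have [p Mp lp] := Mproj l.
suff /eqP : l - p = 0 by rewrite subr_eq0 => /eqP ->.
have lp0 x : g0 (l - p) x = 0.
  have [q Mq xq] := Mproj x.
  rewrite -[x](subrK q) hermitianDr (lp _ Mq) addr0 hermitianBl.
  rewrite [g0 p _]hermitian_conj xq // conjC0 subr0.
  have [b b0 gb] := bg0.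
  apply/eqP; rewrite -normr_le0; apply/ler_addgt0Pr => e e0; rewrite add0r.
  set k := b * (`|x - q| + 1).
  have k0 : 0 < k by rewrite mulr_gt0 // ltr_wpDl.
  have [n un] := ul (e / k) (divr_gt0 e0 k0).
  have -> : g0 l (x - q) = - g0 (u n - l) (x - q).
    by rewrite hermitianBl [g0 (u n) _]hermitian_conj xq // conjC0 sub0r opprK.
  rewrite normrN; apply: le_trans (gb _ _) _.
  rewrite mulrAC mulrC -[e](divfK (lt0r_neq0 k0)).
  apply: ler_pM => //; first by rewrite mulr_ge0 // ltW.
  by rewrite ler_pM2l // lerDl.
have [a a0 ga] := ig0; have [y _] := ga (l - p).
by rewrite lp0 pmulr_rle0 // => /sqr_norm_le0.
Qed.

Hypothesis g0_ge0 : forall x, M x -> 0 <= g0 x x.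

Let M0 : M 0.
Proof. by have [p Mp _] := Mproj 0; have := Mlin (-1) Mp Mp; rewrite scaleN1r addNr. Qed.

Let MZ a x : M x -> M (a *: x).
Proof. by move=> Mx; have := Mlin a Mx M0; rewrite addr0. Qed.

Let g0_CS x y : M x -> M y -> `|g0 x y| ^+ 2 <= g0 x x * g0 y y.
Proof.
move=> Mx My; apply: cauchy_schwarz; last exact: g0_ge0.
by move=> a; rewrite addrC; apply/g0_ge0/Mlin.
Qed.

(** On [M], the energy norm dominates the norm of the space: the functionals
    [g0 (., u)], for [u] in the energy unit ball of [M], are pointwise bounded by
    the Cauchy-Schwarz inequality in [M], so they are uniformly bounded. *)
Lemma orthoprojectable_form_norm :
  exists2 k : C, 0 < k & forall x, M x -> `|x| ^+ 2 <= k * g0 x x.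
Proof.
have [b b0 gb] := bg0; have [a a0 ga] := ig0.
pose A := [set f : F -> C |
  exists u, [/\ M u, g0 u u <= 1 & f = fun x => g0 x u]].
have [|x|k k0 Ak] := @uniform_boundedness _ _ archi A.
- move=> _ [u [_ _ ->]]; split => [c x y|].
    by rewrite hermitianDl hermitianZl.
  exists (b * `|u| + 1); first by rewrite ltr_wpDl // mulr_ge0 // ltW.
  move=> x; apply: le_trans (gb _ _) _.
  by rewrite mulrAC ler_wpM2r // lerDl.
- have [p Mp xp] := Mproj x; exists (g0 p p + 1) => _ [u [Mu u1 ->]].
  have p0 := g0_ge0 Mp.
  have -> : g0 x u = g0 p u.
    by apply/eqP; rewrite -subr_eq0 -hermitianBl xp.
  rewrite -(@ler_pXn2r _ 2) ?nnegrE ?addr_ge0 //.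
  apply: le_trans (g0_CS Mp Mu) _; apply: le_trans (ler_piMr p0 u1) _.
  apply: (@le_trans _ _ (g0 p p + 1)); first by rewrite lerDl.
  by rewrite ler_eXnr // lerDr.
have ka0 : 0 < k / a by rewrite divr_gt0.
have unit_bound u : M u -> g0 u u <= 1 -> `|u| <= k / a.
  move=> Mu u1; have [v vu uv] := ga u.
  have gv : `|g0 v u| <= k * `|v| by apply: (Ak (fun x => g0 x u)); exists u.
  have [->|u0] := eqVneq u 0; first by rewrite normr0 ltW.
  have guv : g0 u v \is Num.real.
    by apply: ger0_real; apply: le_trans uv; rewrite mulr_ge0 ?exprn_ge0 // ltW.
  have : a * `|u| ^+ 2 <= k * `|u|.
    apply: le_trans uv (le_trans (real_ler_norm guv) _).
    by rewrite hermitian_normC; apply: le_trans gv _; rewrite ler_pM2l.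
  rewrite expr2 mulrA ler_pM2r ?normr_gt0 // => au.
  by rewrite ler_pdivlMr // mulrC.
exists ((k / a) ^+ 2); first exact: exprn_gt0.
move=> u Mu; have := g0_ge0 Mu; rewrite le0r => /orP[/eqP u0|u0].
  have [v _] := ga u; have [p Mp vp] := Mproj v.
  have -> : g0 u v = 0.
    have -> : g0 u v = g0 u p.
      apply/eqP; rewrite -subr_eq0 -hermitianBr.
      by rewrite hermitian_conj vp // conjC0.
    have := g0_CS Mu Mp; rewrite u0 mul0r => up.
    exact: sqr_norm_le0.
  by rewrite u0 mulr0 pmulr_rle0.
set t := g0 u u in u0 *.
pose w := (sqrtC t)^-1 *: u.
have st0 : 0 < sqrtC t by rewrite sqrtC_gt0.
have : `|w| <= k / a.
  apply: unit_bound; first exact: MZ.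
  rewrite hermitianZl hermitianZr -/t conj_Creal ?realV ?gtr0_real //.
  have tE : t = sqrtC t * sqrtC t by rewrite -expr2 sqrtCK.
  rewrite [X in _ * (_ * X)]tE.
  by rewrite mulKf ?mulVf ?gt_eqF.
rewrite normrZ normfV (gtr0_norm st0) ler_pdivrMl // => wk.
rewrite -[t in leRHS]sqrtCK -exprMn mulrC lerXn2r ?nnegrE //.
by rewrite mulr_ge0 // ltW.
Qed.

(** The existence part of the Lax-Milgram theorem for [g] in the Hilbert space
    [(M, g0)] (modulo null vectors).  The vector [rep x] represents [g (x, .)] on
    [M] by [g0], and the Richardson iteration [v |-> v + (1/d) rep (w - v)]
    contracts the residual [rep (w - v)] in energy.  The hypothesis on
    representatives makes the regularity for [g0] available to functionals
    defined by [g]. *)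
Lemma orthoprojectable_perturb (g : {hermitian_sym F for (@Num.conj C)})
    (c d : C) : bounded_form g -> 0 < c -> c <= d ->
  (forall x, exists y, forall m, M m -> g x m = g0 y m) ->
  (forall x, M x -> c * g0 x x <= g x x <= d * g0 x x) ->
  orthoprojectable g M.
Proof.
move=> [b b0 gb] c0 cd grep gbnd.
have d0 : 0 < d by apply: lt_le_trans cd.
have g_ge0 x : M x -> 0 <= g x x.
  move=> Mx; have /andP[+ _] := gbnd _ Mx; apply: le_trans.
  by rewrite mulr_ge0 ?g0_ge0 // ltW.
have step x : exists p, M p /\ forall m, M m -> g0 p m = g x m.
  have [y yP] := grep x; have [p Mp yp] := Mproj y.
  exists p; split=> // m Mm; rewrite yP //; apply/esym/eqP.
  by rewrite -subr_eq0 -hermitianBl yp.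
have [rep repP] := choice step.
have repM x : M (rep x) by have [] := repP x.
have {repP}repE x m : M m -> g0 (rep x) m = g x m by have [_] := repP x; apply.
move=> w.
pose u n := iter n (fun v => v + d^-1 *: rep (w - v)) 0.
pose r n := rep (w - u n).
have uS n : u n.+1 = u n + d^-1 *: r n by [].
have Mu n : M (u n).
  elim: n => [|n IHn]; [exact: M0 | rewrite uS addrC].
  exact: Mlin (repM _) IHn.
have rS n m : M m -> g0 (r n.+1) m = g0 (r n) m - d^-1 * g (r n) m.
  by move=> Mm; rewrite [LHS]repE // uS opprD addrA hermitianBl hermitianZl repE.
pose a n := g0 (r n) (r n).
have Mr n : M (r n) := repM _.
have a_ge0 n : 0 <= a n := g0_ge0 (Mr n).
(* With [e = g (r, r)] and [s = rep r], the new energy is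
   [a n - 2 e / d + g0 (s, s) / d^2], and [g0 (s, s) <= d e] by the
   Cauchy-Schwarz inequality for [g]; finally [c a n <= e]. *)
have aS n : a n.+1 <= (1 - c / d) * a n.
  set s := rep (r n); have Ms : M s by apply: repM.
  set e := g (r n) (r n); have e0 : 0 <= e by apply: g_ge0.
  have sr : g0 s (r n) = e by rewrite repE.
  have rs : g0 (r n) s = e by rewrite hermitian_conj sr conj_Creal // ger0_real.
  have ss0 := g0_ge0 Ms.
  have dr : d^-1 \is Num.real by rewrite realV gtr0_real.
  have aE : a n.+1 = a n - d^-1 * e *+ 2 + d^-1 ^+ 2 * g0 s s.
    rewrite /a rS // -repE // -/s.
    rewrite [g0 (r n) (r n.+1)]hermitian_conj [g0 s (r n.+1)]hermitian_conj.
    rewrite !rS // -!repE // -/s rs sr !rmorphB !rmorphM /=.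
    rewrite !(conj_Creal dr) (conj_Creal (ger0_real e0)) (conj_Creal (ger0_real ss0)).
    rewrite conj_Creal ?hermitian_real //; ring.
  have sse : g0 s s <= d * e.
    have [->|ssn0] := eqVneq (g0 s s) 0; first by rewrite mulr_ge0 // ltW.
    have ssp : 0 < g0 s s by rewrite lt_def ssn0.
    rewrite -(ler_pM2r ssp) -expr2 -{1}[g0 s s]ger0_norm // {1}repE //.
    apply: le_trans (cauchy_schwarz _ (g_ge0 _ Ms)) _.
      by move=> z; rewrite addrC; apply/g_ge0/Mlin.
    rewrite -/e mulrC mulrAC; apply: ler_wpM2r => //.
    by have /andP[] := gbnd _ Ms.
  have /andP[ea _] := gbnd _ (Mr n); rewrite -/(a n) -/e in ea.
  apply: (@le_trans _ _ (a n - d^-1 * e)).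
    rewrite aE -addrA lerD2l mulr2n opprD -addrA gerDl addrC subr_le0.
    by rewrite expr2 -mulrA ler_pM2l ?invr_gt0 // ler_pdivrMl.
  rewrite mulrBl mul1r lerD2l lerN2 mulrAC mulrC ler_pM2l ?invr_gt0 //.
have [k k0 kM] := orthoprojectable_form_norm.
have cd1 : 0 <= 1 - c / d < 1.
  by rewrite subr_ge0 ler_pdivrMr // mul1r cd gtrBl divr_gt0.
have /andP[cd0 cdlt1] := cd1.
pose s := sqrtC (1 - c / d).
have s01 : 0 <= s < 1.
  rewrite sqrtC_ge0 cd0 -(@ltr_pXn2r _ 2) ?nnegrE ?sqrtC_ge0 //.
  by rewrite sqrtCK expr1n.
have /andP[s0 s1] := s01.
have s1' : 0 < 1 - s by rewrite subr_gt0.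
(* [t] bounds the steps of the iteration and [q] the distance to its limit. *)
pose t n := d^-1 * sqrtC (k * a n).
have ka0 n : 0 <= k * a n by rewrite mulr_ge0 // ltW.
have t0 n : 0 <= t n by rewrite mulr_ge0 ?sqrtC_ge0 // invr_ge0 ltW.
have tS n : t n.+1 <= s * t n.
  rewrite mulrCA ler_pM2l ?invr_gt0 // -sqrtCM ?nnegrE //.
  have kaS : k * a n.+1 <= (1 - c / d) * (k * a n) by rewrite mulrCA ler_pM2l.
  rewrite ler_sqrtC //; rewrite nnegrE //; exact: le_trans kaS.
have rt n : `|r n| <= d * t n.
  rewrite mulrA divff ?gt_eqF // mul1r.
  rewrite -(@ler_pXn2r _ 2) ?nnegrE ?sqrtC_ge0 // sqrtCK.
  exact: kM.
have ut n : `|u n.+1 - u n| <= t n.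
  rewrite uS addrAC subrr add0r normrZ gtr0_norm ?invr_gt0 //.
  by rewrite ler_pdivrMl.
have [l ul] := geometric_cvg archi s01 ut tS.
pose q n := t n / (1 - s).
have q0 n : 0 <= q n by rewrite divr_ge0 // ltW.
have qS n : q n.+1 <= s * q n by rewrite mulrA ler_pM2r ?invr_gt0.
have q_small := geometric_small archi s01 q0 qS.
have tq n : t n <= q n.
  by rewrite ler_pdivlMr // ler_piMr // gerBl.
have Ml : M l.
  apply: orthoprojectable_closed Mu _ => e /q_small[n qn].
  by exists n; apply: le_trans (ul n) (qn _ _).
exists l => // m Mm; have [b1 b10 g0b] := bg0.
apply/eqP; rewrite -normr_le0; apply/ler_addgt0Pr => e e0; rewrite add0r.
pose K := (b1 * d + b) * (`|m| + 1).
have b1d : 0 < b1 * d + b by rewrite addr_gt0 // mulr_gt0.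
have K0 : 0 < K by rewrite mulr_gt0 // ltr_wpDl.
have [n /(_ n (leqnn n)) qn] := q_small _ (divr_gt0 e0 K0).
have -> : g (w - l) m = g0 (r n) m + g (u n - l) m.
  by rewrite repE // -hermitianDl addrA subrK.
suff : `|g0 (r n) m + g (u n - l) m| <= K * q n.
  by move=> /le_trans; apply; rewrite -ler_pdivlMl // mulrC.
apply: le_trans (ler_normD _ _) _.
apply: le_trans (lerD (g0b _ _) (gb _ _)) _.
rewrite -mulrDl mulrAC.
apply: ler_pM => //; first by rewrite addr_ge0 ?mulr_ge0 // ltW.
  rewrite mulrDl -mulrA lerD // ler_pM2l //.
  by apply: le_trans (rt n) _; rewrite ler_pM2l.
by rewrite lerDl.
Qed.

End regular_positive.

(** * Krein forms and their sums *)

Section krein.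
Variables (C : numClosedFieldType) (F : normedModType C).
Variables (f : {hermitian_sym F for (@Num.conj C)}) (Fp Fm : set F) (a b : C).
Hypotheses (Fp_lin : forall c x y, Fp x -> Fp y -> Fp (c *: x + y))
  (Fm_lin : forall c x y, Fm x -> Fm y -> Fm (c *: x + y)).
Hypotheses (Fp_ge0 : forall x, Fp x -> 0 <= f x x)
  (Fm_le0 : forall x, Fm x -> 0 <= - f x x).
Hypothesis Fpm : forall x y, Fp x -> Fm y -> f x y = 0.
Hypothesis FpmT : forall x, exists xp xm, [/\ Fp xp, Fm xm & x = xp + xm].
Hypotheses (a0 : 0 < a) (b0 : 0 < b).
Hypothesis equiv : forall x y, Fp x -> Fm y ->
  a * `|x + y| ^+ 2 <= f x x - f y y <= b * `|x + y| ^+ 2.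

Let oppf : {hermitian_sym F for (@Num.conj C)}.
Proof.
apply: (@pack_hermitian _ _ (fun x y => - f x y)) => [z c x y|x y].
  by rewrite hermitianDl hermitianZl opprD mulrN.
by rewrite hermitian_conj rmorphN.
Defined.

Let Fmp x y : Fp x -> Fm y -> f y x = 0.
Proof. by move=> Fx Fy; rewrite hermitian_conj Fpm // conjC0. Qed.

Let le_part (x y z u v : C) : `|x| ^+ 2 <= u * v -> 0 <= u -> 0 <= v ->
  u <= b * y ^+ 2 -> v <= b * z ^+ 2 -> 0 <= y -> 0 <= z -> `|x| <= b * y * z.
Proof.
move=> xuv u0 v0 uy vz y0 z0.
rewrite -(@ler_pXn2r _ 2) ?nnegrE ?mulr_ge0 ?(ltW b0) //.
apply: le_trans xuv (le_trans (ler_pM u0 v0 uy vz) _).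
by rewrite !exprMn expr2 mulrACA mulrA.
Qed.

(** The Cauchy-Schwarz inequality holds on each of the two definite parts. *)
Lemma krein_bounded_form : bounded_form f.
Proof.
exists (b + b); first exact: addr_gt0.
move=> x y; have [xp [xm [xpP xmP xE]]] := FpmT x.
have [yp [ym [ypP ymP yE]]] := FpmT y.
have bound u v : Fp u -> Fm v -> 0 <= f u u <= b * `|u + v| ^+ 2 /\
    0 <= - f v v <= b * `|u + v| ^+ 2.
  move=> Fu Fv; have /andP[_ uv] := equiv Fu Fv.
  rewrite Fp_ge0 // Fm_le0 //=; split; apply: le_trans uv.
    by rewrite lerDl Fm_le0.
  by rewrite lerDr Fp_ge0.
have [/andP[xp0 xpb] /andP[xm0 xmb]] := bound _ _ xpP xmP.
have [/andP[yp0 ypb] /andP[ym0 ymb]] := bound _ _ ypP ymP.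
rewrite -xE in xpb xmb; rewrite -yE in ypb ymb.
have -> : f x y = f xp yp + f xm ym.
  by rewrite xE yE hermitianDl !hermitianDr (Fpm xpP ymP) (Fmp ypP xmP) addr0 add0r.
rewrite -mulrA mulrDl !mulrA; apply: le_trans (ler_normD _ _) (lerD _ _).
  apply: le_part xpb ypb _ _ => //; apply: cauchy_schwarz => // c.
  by rewrite addrC; apply/Fp_ge0/Fp_lin.
apply: le_part xmb ymb _ _ => //.
rewrite -normrN; apply: (@cauchy_schwarz _ _ oppf) => // c.
by rewrite addrC; apply/Fm_le0/Fm_lin.
Qed.

(** The norm of [J x = xp - xm] is at most [sqrt (b / a)] times that of [x], whence
    the factor [k] that scales the witness [J x]. *)
Lemma krein_inf_sup_form : inf_sup_form f.
Proof.
pose k := sqrtC (a / b).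
have k0 : 0 < k by rewrite sqrtC_gt0 divr_gt0.
exists (k * a); first exact: mulr_gt0.
move=> x; have [xp [xm [xpP xmP xE]]] := FpmT x.
have mxmP : Fm (- xm).
  have Fm0 : Fm 0 by have := Fm_lin (-1) xmP xmP; rewrite scaleN1r addNr.
  by have := Fm_lin (-1) xmP Fm0; rewrite scaleN1r addr0.
have /andP[lo hi] := equiv xpP xmP; rewrite -xE in lo hi.
have /andP[lo' _] := equiv xpP mxmP.
rewrite linearNl linearNr opprK in lo'.
exists (k *: (xp - xm)).
  rewrite -(@ler_pXn2r _ 2) ?nnegrE // normrZ exprMn (gtr0_norm k0) sqrtCK.
  rewrite mulrAC ler_pdivrMr //; apply: le_trans lo' _.
  by rewrite mulrC.
rewrite hermitianZr conj_Creal ?gtr0_real // -mulrA ler_pM2l //.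
have -> // : f x (xp - xm) = f xp xp - f xm xm.
by rewrite xE hermitianDl !hermitianBr (Fpm xpP xmP) (Fmp xpP xmP) subr0 sub0r.
Qed.

End krein.

Section sum_form.
Variables (C : numClosedFieldType) (K E : normedModType C).
Variables (kf : {hermitian_sym K for (@Num.conj C)}).
Variables (ef : {hermitian_sym E for (@Num.conj C)}).
Variable r : C.
Hypothesis r_real : r \is Num.real.

Definition sum_form (p q : K * E) := kf p.1 q.1 + r * ef p.2 q.2.

Definition hermitian_sum_form : {hermitian_sym (K * E)%type for (@Num.conj C)}.
Proof.
apply: (@pack_hermitian _ _ sum_form) => [z c x y|x y].
  by rewrite /sum_form !hermitianDl !hermitianZl; ring.
rewrite /sum_form hermitian_conj [ef _ _]hermitian_conj.
by rewrite rmorphD rmorphM /= (conj_Creal r_real).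
Defined.

Lemma bounded_sum_form : bounded_form kf -> bounded_form ef ->
  bounded_form sum_form.
Proof.
move=> [b b0 kb] [d d0 eb]; exists (b + `|r| * d).
  by rewrite ltr_wpDr // mulr_ge0 // ltW.
have part (p q : K * E) : [/\ `|p.1| <= `|p| & `|p.2| <= `|p|].
  by rewrite prod_normE !comparable_le_max ?real_comparable ?normr_real // !lexx orbT.
move=> p q; have [p1 p2] := part p q; have [q1 q2] := part q p.
rewrite -mulrA mulrDl; apply: le_trans (ler_normD _ _) (lerD _ _).
  by apply: le_trans (kb _ _) _; rewrite -mulrA ler_pM2l // ler_pM.
rewrite normrM -mulrA ler_wpM2l //.
by apply: le_trans (eb _ _) _; rewrite -mulrA ler_pM2l // ler_pM.
Qed.

(** The sign of [r] is absorbed by the second component of the witness; the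
    constant is half the harmonic mean of [a] and [|r| d], a common lower bound
    of the two. *)
Lemma inf_sup_sum_form : r != 0 -> inf_sup_form kf -> inf_sup_form ef ->
  inf_sup_form sum_form.
Proof.
move=> rn0 [a a0 ka] [d d0 ed].
have r0 : 0 < `|r| by rewrite normr_gt0.
have rd0 : 0 < `|r| * d by rewrite mulr_gt0.
have max_real (p : K * E) : `|p| = `|p.1| \/ `|p| = `|p.2|.
  by rewrite prod_normE maxEle; case: ifP => _; [right|left].
have ard0 : 0 < a + `|r| * d by rewrite addr_gt0.
exists (a * (`|r| * d) / (a + `|r| * d)); first by rewrite divr_gt0 // mulr_gt0.
move=> p; have [y1 y1p ky1] := ka p.1; have [y2 y2p ey2] := ed p.2.
exists (y1, (r / `|r|) *: y2).
  rewrite !prod_normE /= normrZ normrM normfV normr_id divff ?gt_eqF // mul1r.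
  rewrite comparable_ge_max ?real_comparable ?normr_real //.
  by rewrite !comparable_le_max ?real_comparable ?normr_real // y1p y2p orbT.
rewrite /sum_form /= hermitianZr conj_Creal ?realM ?realV ?normr_real //.
rewrite mulrA.
have -> : r * (r / `|r|) = `|r|.
  by rewrite mulrA -expr2 -real_normK // expr2 mulfK // gt_eqF.
apply: le_trans (lerD ky1 (ler_wpM2l (ltW r0) ey2)).
have k1 : 0 <= a * `|p.1| ^+ 2 by rewrite mulr_ge0 ?exprn_ge0 // ltW.
have k2 : 0 <= `|r| * (d * `|p.2| ^+ 2) by rewrite !mulr_ge0 ?exprn_ge0 // ltW.
rewrite mulrAC ler_pdivrMr //.
have [->|->] := max_real p.
  rewrite [leLHS](_ : _ = a * `|p.1| ^+ 2 * (`|r| * d)); last by ring.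
  by apply: ler_pM; rewrite // ?lerDl ?lerDr // ltW.
rewrite [leLHS](_ : _ = `|r| * (d * `|p.2| ^+ 2) * a); last by ring.
by apply: ler_pM; rewrite // ?lerDl ?lerDr // ltW.
Qed.
End sum_form.

(** * Complex Krein spaces and regular subspaces *)

Lemma complex_archimedean (R : realType) : Num.archimedean_axiom R[i].
Proof.
move=> x; have xE : ((complex.Re `|x|)%:C)%C = `|x|.
  exact/RRe_real/ger0_real.
exists (Num.bound (complex.Re `|x|)).
rewrite -xE -(rmorph_nat (real_complex R)) ltcR archi_boundP //.
by rewrite -ler0c xE normr_ge0.
Qed.

Section regular_subspace.
Variables (R : realType) (F : lmodType R[i]) (g : F -> F -> R[i]) (M : set F).

Lemma submod_closedP : submod_closed [in M] ->
  forall a x y, M x -> M y -> M (a *: x + y).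
Proof.
move=> [_ Mlin] a x y Mx My.
by have := Mlin a x y; rewrite !in_setE => /(_ Mx My).
Qed.

Lemma regular_subspaceP :
  regular_subspace g M <-> submod_closed [in M] /\ orthoprojectable g M.
Proof.
split=> -[Mlin Mreg]; split=> //.
  move=> x; have : [set: F] x by []. rewrite -Mreg => -[p Mp [q Mq <-]].
  by exists p => // m Mm; rewrite addrAC subrr add0r Mq.
rewrite -subTset => x _; have [p Mp xp] := Mreg x.
by exists p => //; exists (x - p) => //; rewrite addrC subrK.
Qed.
End regular_subspace.

Lemma krein_space_form (R : realType) (F : completeNormedModType R[i])
    (f : {hermitian_sym F for (@Num.conj R[i])}) :
  krein_space f -> bounded_form f /\ inf_sup_form f.
Proof.
move=> [Fp [Fm [[[Fp_lin Fp_gt0 _] [Fm_lin Fm_lt0 _] ort FT] [a [b [a0 b0 ab]]]]]].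
have Fp_ge0 x : Fp x -> 0 <= f x x.
  have [->|x0] := eqVneq x 0; first by rewrite linear0l.
  by move=> Fx; rewrite ltW // Fp_gt0.
have Fm_le0 x : Fm x -> 0 <= - f x x.
  have [->|x0] := eqVneq x 0; first by rewrite linear0l oppr0.
  by move=> Fx; rewrite ltW // Fm_lt0.
have dec x : exists xp xm, [/\ Fp xp, Fm xm & x = xp + xm].
  have : [set: F] x by []. by rewrite -FT => -[y Fy [z Fz <-]]; exists y, z.
have := submod_closedP Fp_lin; have := submod_closedP Fm_lin => mlin plin.
split; first exact: krein_bounded_form mlin Fp_ge0 Fm_le0 ort dec b0 ab.
exact: (krein_inf_sup_form mlin ort dec a0 b0 ab).
Qed.

(** * The interval of parameters *)

Section rho_interval.
Variables (R : realType) (H K E : lmodType R[i]).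
Variables (kf : {hermitian_sym K for (@Num.conj R[i])}).
Variables (ef : {hermitian_sym E for (@Num.conj R[i])}).
Variables (T : H -> K) (V : H -> E).
Hypothesis TV : forall y, ef (V y) (V y) = 0 -> 0 <= kf (T y) (T y).

Let t x := complex.Re (kf (T x) (T x)).
Let v x := complex.Re (ef (V x) (V x)).

Let tE x : kf (T x) (T x) = ((t x)%:C)%C.
Proof. by rewrite RRe_real ?hermitian_real. Qed.

Let vE x : ef (V x) (V x) = ((v x)%:C)%C.
Proof. by rewrite RRe_real ?hermitian_real. Qed.

Lemma rho_minus_le (rho : R) x : (rho_minus kf ef T V <= rho%:E)%E ->
  0 < v x -> 0 <= t x + rho * v x.
Proof.
rewrite /rho_minus leeNl => le_inf v0.
have /(le_trans le_inf) : (ereal_inf [set (rho_quotient kf ef T V x)%:E |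
     x in [set x | (0 < ef (V x) (V x))%R]] <= (rho_quotient kf ef T V x)%:E)%E.
  by apply: ereal_inf_lbound; exists x => //=; rewrite vE ltcR.
rewrite lee_fin /rho_quotient -/(t x) -/(v x) ler_pdivlMr //.
by rewrite mulNr -subr_ge0 opprK.
Qed.

Lemma rho_plus_ge (rho : R) x : (rho%:E <= rho_plus kf ef T V)%E ->
  v x < 0 -> 0 <= t x + rho * v x.
Proof.
rewrite /rho_plus leeNr => le_sup v0.
have /le_trans/(_ le_sup) : ((rho_quotient kf ef T V x)%:E <=
    ereal_sup [set (rho_quotient kf ef T V x)%:E |
     x in [set x | (ef (V x) (V x) < 0)%R]])%E.
  by apply: ereal_sup_ubound; exists x => //=; rewrite vE ltcR.
rewrite lee_fin /rho_quotient -/(t x) -/(v x) ler_ndivrMr //.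
by rewrite mulNr -subr_ge0 opprK.
Qed.

(** In the open interval, [rho] can be replaced by some [r1 < rho] and some
    [r2 > rho] for which the form is still nonnegative; the first gives the bound
    where [v x > 0], the second where [v x < 0]. *)
Lemma rho_interval_coercive (rho : R) :
  (rho_minus kf ef T V < rho%:E < rho_plus kf ef T V)%E ->
  exists2 d : R, 0 < d & forall x, d * `|v x| <= t x + rho * v x.
Proof.
move=> /andP[lo hi].
have [r1 r1rho lo1] : exists2 r1, r1 < rho & (rho_minus kf ef T V <= r1%:E)%E.
  case: (rho_minus _ _ _ _) lo => [m|//|_].
    by rewrite lte_fin => mrho; exists m.
  by exists (rho - 1); rewrite ?leNye // gtrBl.
have [r2 r2rho hi2] : exists2 r2, rho < r2 & (r2%:E <= rho_plus kf ef T V)%E.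
  case: (rho_plus _ _ _ _) hi => [m||//].
    by rewrite lte_fin => mrho; exists m.
  by exists (rho + 1); rewrite ?leey // ltrDl.
exists (Num.min (rho - r1) (r2 - rho)); first by rewrite lt_min !subr_gt0 r1rho.
move=> x; have [v0|v0|v0] := ltgtP (v x) 0.
- have := rho_plus_ge hi2 v0; rewrite ltr0_norm //.
  have : Num.min (rho - r1) (r2 - rho) <= r2 - rho by rewrite ge_min lexx orbT.
  nra.
- have := rho_minus_le lo1 v0; rewrite gtr0_norm //.
  have : Num.min (rho - r1) (r2 - rho) <= rho - r1 by rewrite ge_min lexx.
  nra.
- rewrite v0 normr0 !mulr0 addr0 -lecR -tE.
  by apply: TV; rewrite vE v0.
Qed.
End rho_interval.

(** * Independence of the parameter *)

Theorem corollary4p15 (R : realType) (H K E : completeNormedModType R[i])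
  (dot : {dot H for Num.conj})
  (kf : {hermitian_sym K for Num.conj}) (ef : {hermitian_sym E for Num.conj})
  (T : {linear H -> K}) (V : {linear H -> E})
  (hH : hilbert_space dot) (sH : separable_space H)
  (hK : krein_space kf) (hE : krein_space ef)
  (cT : continuous T) (cV : continuous V)
  (rT : closed (range T)) (rV : closed (range V))
  (iT : indefinite dot (krein_adjoint dot kf T \o T))
  (iV : indefinite dot (krein_adjoint dot ef V \o V))
  (TV : forall y : H, ef (V y) (V y) = 0 -> 0 <= kf (T y) (T y))
  (L : H -> K * E) (LE : forall x : H, L x = (T x, V x))
  (rho_neq : rho_minus kf ef T V <> rho_plus kf ef T V) :
  (exists rho0 : R,
     (rho_minus kf ef T V < rho0%:E < rho_plus kf ef T V)%E /\
     regular_subspace (rho_form kf ef rho0) (range L)) ->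
  forall rho : R, (rho_minus kf ef T V < rho%:E < rho_plus kf ef T V)%E ->
    regular_subspace (rho_form kf ef rho) (range L).
Proof.
move=> [rho0 [rho0I /regular_subspaceP [Llin Lreg]]] rho rhoI.
apply/regular_subspaceP; split=> //.
have [bk ik] := krein_space_form hK; have [be ie] := krein_space_form hE.
have coercive := rho_interval_coercive TV.
(* At [s = 0] the form of [T^# T] would be positive.  Where the adjoint has its
   default value, [dot (T^# T x) x = 0] is not negative either. *)
have nonzero (s : R) : (rho_minus kf ef T V < s%:E < rho_plus kf ef T V)%E ->
    s != 0.
  move=> sI; apply/eqP => s0; have [d d0 dP] := coercive _ sI.
  have [_ [x]] := iT.
  rewrite /krein_adjoint /=; case: xgetP => [z _ zP|_]; last first.
    by rewrite linear0l ltxx.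
  have -> : dot z x = kf (T x) (T x).
    by rewrite hermitian_conj [RHS]hermitian_conj (zP x).
  have := dP x; rewrite s0 mul0r addr0 => /(le_trans _) tx.
  have : 0 <= kf (T x) (T x).
    rewrite -[kf _ _]RRe_real ?hermitian_real // ler0c; apply: tx.
    by rewrite mulr_ge0 // ltW.
  by move=> /le_lt_trans h /h; rewrite ltxx.
have rn0 := nonzero _ rhoI; have r0n0 := nonzero _ rho0I.
have rR (s : R) : (s%:C)%C \is Num.real by apply/complex_realP; exists s.
have rC0 : (rho0%:C)%C != 0 :> R[i] by rewrite (inj_eq (@complexI _)).
pose g s := hermitian_sum_form kf ef (rR s).
have bg s : bounded_form (g s) := bounded_sum_form _ bk be.
have ig : inf_sup_form (g rho0) := inf_sup_sum_form (rR rho0) rC0 ik ie.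
have [d0 d00 d0P] := coercive _ rho0I; have [d1 d10 d1P] := coercive _ rhoI.
pose t x := complex.Re (kf (T x) (T x)).
pose v x := complex.Re (ef (V x) (V x)).
have gE s x : g s (L x) (L x) = ((t x + s * v x)%:C)%C.
  rewrite LE rmorphD rmorphM /= /t /v.
  by rewrite !RRe_real ?hermitian_real.
(* Each of the two forms is bounded by a multiple of the other one, because the
   difference of parameters multiplies [v], which both forms control. *)
have c1 (p q d : R) : 0 < d -> (forall x, d * `|v x| <= t x + p * v x) ->
    forall x, t x + q * v x <= (1 + `|q - p| / d) * (t x + p * v x).
  move=> dp dP x.
  have -> : t x + q * v x = t x + p * v x + (q - p) * v x by ring.
  rewrite [leRHS]mulrDl mul1r lerD2l; apply: le_trans (ler_norm _) _.
  rewrite normrM -mulrA ler_wpM2l //.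
  by rewrite ler_pdivlMl.
pose k0 := 1 + `|rho - rho0| / d0; pose k1 := 1 + `|rho0 - rho| / d1.
have k01 : 1 <= k0 by rewrite lerDl divr_ge0 // ltW.
have k11 : 1 <= k1 by rewrite lerDl divr_ge0 // ltW.
have k1p : 0 < k1 by apply: lt_le_trans k11.
apply: (orthoprojectable_perturb (@complex_archimedean R) (bg rho0) ig
  (submod_closedP Llin) Lreg _ (g := g rho) (c := (k1^-1%:C)%C) (d := (k0%:C)%C)).
- move=> _ [x _ <-]; rewrite gE ler0c; apply: le_trans (d0P x).
  by rewrite mulr_ge0 // ltW.
- exact: bg.
- by rewrite ltcR invr_gt0.
- by rewrite lecR; apply: le_trans k01; rewrite invf_le1.
- move=> w; exists (w.1, ((rho / rho0)%:C)%C *: w.2) => m _.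
  rewrite /g /= /sum_form /= hermitianZl mulrA -rmorphM.
  by rewrite mulrCA mulfV ?mulr1.
(* Stated apart, because matching [g rho0] against [g rho] in a rewrite would
   compare the two forms by unfolding them. *)
- have transfer (y z y' z' c d : R[i]) : y = y' -> z = z' ->
      c * y' <= z' <= d * y' -> c * y <= z <= d * y by move=> -> ->.
  move=> _ [x _ <-]; apply: (transfer _ _ _ _ _ _ (gE rho0 x) (gE rho x)).
  by rewrite -!(rmorphM (real_complex R)) !lecR ler_pdivrMl // !c1.
Qed.
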